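(* Let $k$ be a field, let $\lambda = (\lambda_1,\ldots,\lambda_n)$ be a partition with $\lambda_1 = m$, and let $J_\lambda \subseteq S = k[x_1,\ldots,x_n,y_1,\ldots,y_m]$ be the cover ideal of the Ferrers graph $G_\lambda$. Let $d(\lambda)$ be the number of distinct parts of $\lambda$. Then, for all integers $t \ge 1$, $$\operatorname{pd}(S/J_\lambda^t) = 1 + \min\{t, d(\lambda)\}.$$
   Context: A partition $\lambda = (\lambda_1,\ldots,\lambda_n)$ is a non-increasing sequence of positive integers $\lambda_1 \ge \lambda_2 \ge \cdots \ge \lambda_n \ge 1$ (with $n \ge 1$). Its number of distinct parts is $d(\lambda) = |\{\lambda_1,\ldots,\lambda_n\}|$. Put $m = \lambda_1$. The Ferrers graph $G_\lambda$ is the bipartite graph with vertex set $\{x_1,\ldots,x_n\} \cup \{y_1,\ldots,y_m\}$ and edge set $E(G_\lambda) = \{\{x_i,y_j\} \mid 1 \le i \le n,\ 1 \le j \le \lambda_i\}$. Let $S = k[x_1,\ldots,x_n,y_1,\ldots,y_m]$ be the standard graded polynomial ring over the field $k$, whose variables are identified with the vertices of $G_\lambda$. The cover ideal of $G_\lambda$ is $$J_\lambda = \bigcap_{\{x_i,y_j\} \in E(G_\lambda)} (x_i,y_j) \subseteq S.$$ $J_\lambda^t$ denotes the ordinary $t$-th power of $J_\lambda$, and $\operatorname{pd}$ denotes projective dimension as an $S$-module. *)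

(* Defs.v *)
From HB Require Import structures.
From mathcomp Require Import all_boot all_order all_algebra.
From mathcomp Require Import boolp classical_sets.
From mathcomp Require Import mpoly.

Set Implicit Arguments.
Unset Strict Implicit.
Unset Printing Implicit Defensive.

Import GRing.Theory.

Local Open Scope ring_scope.
Local Open Scope quotient_scope.
Local Open Scope classical_set_scope.

Section QuotientModule.
Variables (R : nzRingType) (V : lmodType R) (U : submodClosed V).

(* The structure submodClosed does not imply zmodClosed, which {ideal_quot _} needs,
   although over a ring its instances are closed under opposite. *)
Definition submod_pred : {pred V} := fun v => v \in U.

Lemma submod_pred_zmod_closed : zmod_closed submod_pred.
Proof.
split=> [|u v Uu Uv]; first exact: (rpred0 U).
by apply: (rpredD (S := U)) => //; rewrite -scaleN1r; apply: (rpredZ (s := U)).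
Qed.

HB.instance Definition _ := GRing.isZmodClosed.Build V submod_pred
  submod_pred_zmod_closed.

Definition quot_mod : Type := {ideal_quot submod_pred}.
HB.instance Definition _ := GRing.Zmodule.on quot_mod.
HB.instance Definition _ := ZmodQuotient.on quot_mod.

Local Notation Q := quot_mod.

Definition quot_scale (a : R) (q : Q) : Q := \pi_Q (a *: repr q).

Lemma quot_scale_pi a (v : V) : quot_scale a (\pi_Q v) = \pi_Q (a *: v).
Proof.
have pi_eq (x y : V) : x - y \in U -> \pi_Q x = \pi_Q y.
  by move=> xyU; apply/eqP; rewrite -(Quotient.idealrBE submod_pred).
rewrite /quot_scale; apply: pi_eq; rewrite -scalerBr.
apply: (rpredZ (s := U)); rewrite -[_ \in U]/(_ \in submod_pred).
by rewrite Quotient.idealrBE; apply/eqP; apply: reprK.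
Qed.

Lemma quot_scaleA a b (q : Q) :
  quot_scale a (quot_scale b q) = quot_scale (a * b) q.
Proof.
elim/quotW: q => v; rewrite (quot_scale_pi b) (quot_scale_pi a).
by rewrite (quot_scale_pi (a * b)) scalerA.
Qed.

Lemma quot_scale1 : left_id 1 quot_scale.
Proof. by elim/quotW => v; rewrite quot_scale_pi scale1r. Qed.

Lemma quot_scaleDr : right_distributive quot_scale +%R.
Proof.
move=> a; elim/quotW => v; elim/quotW => w.
by rewrite -(raddfD \pi_Q) (quot_scale_pi a (v + w)) !(quot_scale_pi a) scalerDr (raddfD \pi_Q).
Qed.

Lemma quot_scaleDl (q : Q) : {morph quot_scale^~ q : a b / a + b}.
Proof.
elim/quotW: q => v a b.
by rewrite (quot_scale_pi (a + b)) (quot_scale_pi a) (quot_scale_pi b) scalerDl (raddfD \pi_Q).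
Qed.

HB.instance Definition _ := GRing.Zmodule_isLmodule.Build R Q
  quot_scaleA quot_scale1 quot_scaleDr quot_scaleDl.

End QuotientModule.

Section Ideals.
Variable R : comNzRingType.

(* An ideal of R is a submodule of R^o. *)
Definition ideal_gen (A : set R) : {pred R^o} :=
  fun f => `[< exists2 s : seq (R * R), (forall p, p \in s -> A p.2) &
                 f = \sum_(p <- s) p.1 * p.2 >].

Lemma ideal_gen_zmod_closed A : zmod_closed (ideal_gen A).
Proof.
split; first by apply/asboolP; exists [::]; rewrite ?big_nil.
move=> f g /asboolP[s As ->] /asboolP[u Au ->]; apply/asboolP.
exists (s ++ [seq (- p.1, p.2) | p <- u]).
  by move=> p; rewrite mem_cat => /orP[/As //|/mapP[q /Au Aq ->]].
rewrite big_cat big_map -sumrN; congr (_ + _).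
by apply: eq_bigr => p _; rewrite mulNr.
Qed.

Lemma ideal_gen_scaler_closed A : scaler_closed (ideal_gen A).
Proof.
move=> a f /asboolP[s As ->]; apply/asboolP.
exists [seq (a * p.1, p.2) | p <- s].
  by move=> p /mapP[q /As Aq ->].
rewrite big_map scaler_sumr; apply: eq_bigr => p _; exact: mulrA.
Qed.

HB.instance Definition _ A := GRing.isZmodClosed.Build R^o (ideal_gen A)
  (ideal_gen_zmod_closed A).
HB.instance Definition _ A := GRing.isScaleClosed.Build R R^o (ideal_gen A)
  (@ideal_gen_scaler_closed A).

Definition ideal_pow (I : set R) (t : nat) : submodClosed R^o :=
  ideal_gen [set f | exists2 u : t.-tuple R,
                       (forall i, I (tnth u i)) & f = \prod_(i < t) tnth u i].

End Ideals.

Section ProjectiveDimension.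
Variable R : nzRingType.

Definition projective (P : lmodType R) : Prop :=
  forall (M N : lmodType R) (g : {linear M -> N}) (f : {linear P -> N}),
    (forall y, exists x, g x = y) ->
    exists h : {linear P -> M}, forall x, g (h x) = f x.

(* 0 -> P_l -> ... -> P_1 -> P_0 -> M -> 0, padded by zero modules P_i for
   i > l. *)
Record proj_resolution (M : lmodType R) (l : nat) := ProjResolution {
  res_mod : nat -> lmodType R;
  res_diff : forall i, {linear res_mod i.+1 -> res_mod i};
  res_aug : {linear res_mod 0%N -> M};
  res_projective : forall i, projective (res_mod i);
  res_aug_surj : forall y, exists x, res_aug x = y;
  res_exact0 : forall x, res_aug x = 0 <-> exists z, res_diff 0%N z = x;
  res_exact : forall i x,
    res_diff i x = 0 <-> exists z, res_diff i.+1 z = x;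
  res_length : forall i, (l < i)%N -> forall x : res_mod i, x = 0
}.

Definition pd_le (M : lmodType R) (l : nat) : Prop :=
  inhabited (proj_resolution M l).

(* pd M = l; false for every l when M has no finite projective resolution. *)
Definition pd_eq (M : lmodType R) (l : nat) : Prop :=
  pd_le M l /\ forall l', pd_le M l' -> (l <= l')%N.

End ProjectiveDimension.

Definition is_partition (lam : seq nat) : bool :=
  [&& lam != [::], sorted geq lam & all (leq 1) lam].

Definition distinct_parts (lam : seq nat) : nat := size (undup lam).

Section FerrersGraph.
Variable lam : seq nat.

Local Notation n := (size lam).
Local Notation m := (head 0%N lam).

Definition xvert (i : 'I_n) : 'I_(n + m) := lshift m i.
Definition yvert (j : 'I_m) : 'I_(n + m) := rshift n j.

(* Indices start at 0, so that j <= lambda_i becomes j < nth 0 lam i. *)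
Definition ferrers_edges : {set {set 'I_(n + m)}} :=
  [set [set xvert ij.1; yvert ij.2]
     | ij : 'I_n * 'I_m & (ij.2 < nth 0%N lam ij.1)%N]%SET.

End FerrersGraph.

Section CoverIdeal.
Variables (k : fieldType) (p : nat) (E : {set {set 'I_p}}).

Definition cover_ideal : set {mpoly k[p]} :=
  \bigcap_(e in [set` E])
    [set` ideal_gen [set ('X_v : {mpoly k[p]}) | v in [set` e]]].

End CoverIdeal.

Arguments cover_ideal k {p} E%_SET _.

(* Main.v *)
Require Import Defs.
From HB Require Import structures.
From mathcomp Require Import all_boot all_order all_algebra.
From mathcomp Require Import boolp classical_sets.
From mathcomp Require Import mpoly ring zify.

(** The distinct parts of the partition cut the x's into blocks (rows of equal
    length) and the y's into blocks (columns of equal length).  Writing [u c] and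
    [v c] for the products of the variables of the blocks, [0 <= c < d], the
    minimal vertex covers of the Ferrers graph are the [d + 1] monomials
    [u 0 ... u (c-1) v c ... v (d-1)].  Let [J c] be the ideal defined in the same
    way by the first [c] blocks only, and [U c = u 0 ... u (c-1)].  Then
    [J (c+1) = v c * J c + (U (c+1))], hence
      [J (c+1) ^ (t+1) = v c ^ (t+1) * J c ^ (t+1) + U (c+1) * J (c+1) ^ t],
    and the intersection of the two summands is [v c ^ (t+1) * U (c+1) * J c ^ t].
    This is a short exact sequence
      [0 -> J c ^ t -> J c ^ (t+1) (+) J (c+1) ^ t -> J (c+1) ^ (t+1) -> 0]
    whose left map is [(u c * alpha, v c * beta)], with [alpha] and [beta] the
    multiplications by [U c] and [v c ^ t] (up to sign).

    Induction on [c] and [t] then shows that [J c ^ t] has projective dimension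
    [minn c t] and nonzero [Ext ^ (minn c t)] into the residue field.  The upper
    bound holds because the mapping cone of a lift of the left map resolves the
    third ideal.  For the lower bound, [u c] and [v c] kill the residue field, so
    the left map induces zero on Ext into it, and the connecting map
    embeds [Ext ^ i (J c ^ t)] into [Ext ^ (i+1) (J (c+1) ^ (t+1))]
    ([cone_ext_nonzero]).  The passage from [J] to [S/J] adds one, and a comparison
    of resolutions ([ext_nonzero_length]) shows that a nonzero Ext in degree [i]
    prevents resolutions shorter than [i].

    The exactness of the sequence ([chain_pow_syzygy]) needs that [v c] is regular
    modulo the powers of [J c] and coprime to [U (c+1)].  Both follow from the
    existence of an additive operator, division by the monomial [v c] on the
    monomials that it divides and zero on the others, which commutes with
    multiplication by monomials coprime to [v c] and therefore preserves the ideals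
    that such monomials generate. *)

Set Implicit Arguments.
Unset Strict Implicit.
Unset Printing Implicit Defensive.

Import GRing.Theory.
Local Open Scope ring_scope.

(** * Projective modules *)

Definition mk_linear (R : nzRingType) (M N : lmodType R) (f : M -> N)
    (fL : linear f) : {linear M -> N} :=
  HB.pack f (GRing.isLinear.Build R M N *:%R f fL).

Section Projective.
Variable R : nzRingType.
Implicit Types M N P Q : lmodType R.

Section Image.
Variables (M N : lmodType R) (g : {linear M -> N}).

Definition img_pred : {pred N} := fun y => `[< exists x, g x = y >].

Lemma img_submod_closed : submod_closed img_pred.
Proof.
split=> [|a u v /asboolP[x <-] /asboolP[y <-]]; apply/asboolP.
  by exists 0; rewrite linear0.
by exists (a *: x + y); rewrite linearP.
Qed.

HB.instance Definition _ :=
  GRing.isSubmodClosed.Build R N img_pred img_submod_closed.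

Record img := Img { img_val : N; _ : img_val \in img_pred }.

HB.instance Definition _ := [isSub for img_val].
HB.instance Definition _ := [Choice of img by <:].
HB.instance Definition _ := [SubChoice_isSubLmodule of img by <:].

End Image.

(** Projectivity is stated for surjections; restricting the codomain of [g] to its
    image turns it into the form that chain-level constructions use. *)
Lemma projective_lift P M N (f : {linear P -> N}) (g : {linear M -> N}) :
    projective P -> (forall x, exists y, g y = f x) ->
  exists h : {linear P -> M}, forall x, g (h x) = f x.
Proof.
move=> projP im_f.
have g_in y : g y \in img_pred g by apply/asboolP; exists y.
have f_in x : f x \in img_pred g by apply/asboolP/im_f.
have gL : linear (fun y => Img (g_in y)).
  by move=> a x y; apply: val_inj; rewrite /= linearP.
have fL : linear (fun x => Img (f_in x)).
  by move=> a x y; apply: val_inj; rewrite /= linearP.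
have [|h gh] := projP _ _ (mk_linear gL) (mk_linear fL).
  case=> y y_in; have /asboolP[x gx] := y_in.
  by exists x; apply: val_inj.
by exists h => x; have /(congr1 val) := gh x.
Qed.

Lemma projective_regular : projective (R^o : lmodType R).
Proof.
move=> M N g f g_surj; have [x gx] := g_surj (f 1).
have hL : linear (fun r : R^o => (r : R) *: x).
  by move=> a r s; rewrite scalerDl scalerA.
exists (mk_linear hL) => r.
by rewrite /= linearZ /= gx -linearZ /= -[r *: 1]/(r * 1) mulr1.
Qed.

Lemma projective_prod P Q :
  projective P -> projective Q -> projective (P * Q : lmodType R)%type.
Proof.
move=> projP projQ M N g f g_surj.
have f1L : linear (fun x : P => f (x, 0)).
  by move=> a x y; rewrite -linearP; congr (f (_, _)); rewrite /= scaler0 addr0.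
have f2L : linear (fun y : Q => f (0, y)).
  by move=> a x y; rewrite -linearP; congr (f (_, _)); rewrite /= scaler0 addr0.
have [h1 gh1] := projP _ _ g (mk_linear f1L) g_surj.
have [h2 gh2] := projQ _ _ g (mk_linear f2L) g_surj.
have hL : linear (fun z : P * Q => h1 z.1 + h2 z.2).
  by move=> a x y; rewrite !linearP /= scalerDr addrACA.
exists (mk_linear hL) => -[x y].
rewrite /= linearD /= gh1 gh2 /= -linearD; congr (f (_, _)).
  by rewrite /= addr0.
by rewrite /= add0r.
Qed.

Lemma projective_trivial P : (forall x : P, x = 0) -> projective P.
Proof.
move=> P0 M N g f _.
have hL : linear (fun _ : P => 0 : M) by move=> a x y; rewrite scaler0 addr0.
by exists (mk_linear hL) => x; rewrite /= linear0 (P0 x) linear0.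
Qed.

End Projective.

(** * Resolutions and Ext classes *)

Section Resolutions.
Variable R : nzRingType.

Section Cycles.
Variables (M : lmodType R) (T : nat -> lmodType R).
Variables (d : forall i, {linear T i.+1 -> T i}) (e : {linear T 0%N -> M}).

(** In degree 0 the differential is replaced by the augmentation, which makes the
    first step of the inductions below an instance of the general one. *)
Definition is_cycle i : T i -> Prop :=
  match i with
  | 0 => fun x => e x = 0
  | j.+1 => fun x => d j x = 0
  end.

End Cycles.

(** A projective resolution of the submodule [I] of [M], given by a map to [M] with
    image [I].  For ideals this avoids a type for each of them. *)
Record resolution (M : lmodType R) (I : M -> Prop) (l : nat) := Resolution {
  term : nat -> lmodType R;
  diff : forall i, {linear term i.+1 -> term i};
  aug : {linear term 0%N -> M};
  term_projective : forall i, projective (term i);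
  aug_image : forall y, I y <-> exists x, aug x = y;
  cycleP : forall i x, is_cycle diff aug x <-> exists z, diff i z = x;
  term_length : forall i, (l < i)%N -> forall x : term i, x = 0
}.

Variables (M : lmodType R) (I : M -> Prop).

Lemma cycle_diff l (F : resolution I l) i (x : term F i.+1) :
  is_cycle (diff F) (aug F) (diff F i x).
Proof. by apply/cycleP; exists x. Qed.

Lemma diff0 l (F : resolution I l) i (x : term F i.+2) :
  diff F i (diff F i.+1 x) = 0.
Proof. by have := @cycle_diff _ F i.+1 x. Qed.

Variable K : lmodType R.

Definition coboundary l (F : resolution I l) i : {linear term F i -> K} -> Prop :=
  match i with
  | 0 => fun phi => forall x, phi x = 0
  | j.+1 => fun phi =>
      exists psi : {linear term F j -> K}, forall x, phi x = psi (diff F j x)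
  end.

(** [Ext ^ i (I, K)] is nonzero, as computed from the resolution [F] of [I]. *)
Definition ext_nonzero l (F : resolution I l) i : Prop :=
  exists2 phi : {linear term F i -> K},
    (forall x, phi (diff F i x) = 0) & ~ coboundary phi.

End Resolutions.

Arguments term_projective {R M I l} r i.
Arguments cycleP {R M I l} r [i] x.
Arguments term_length {R M I l} r [i].
Arguments ext_nonzero {R M I} K {l} F i.

Section Comparison.
Variables (R : nzRingType) (M : lmodType R) (I : M -> Prop) (l l' : nat).
Variables (F : resolution I l) (P : resolution I l').

Let cycF i (x : term F i) := is_cycle (diff F) (aug F) x.
Let cycP i (x : term P i) := is_cycle (diff P) (aug P) x.

(** Lifting the identity both ways gives chain maps [f], [g] and a homotopy [s] from
    the identity to [g \o f].  The induction only has to remember how they act on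
    cycles, so no sequence of maps is built. *)
Lemma comparison i :
  exists (f : {linear term F i -> term P i}) (g : {linear term P i -> term F i})
         (s : {linear term F i -> term F i.+1}),
    [/\ forall x, cycF x -> cycP (f x), forall x, cycP x -> cycF (g x)
      & forall x, cycF x -> x - g (f x) = diff F i (s x)].
Proof.
elim: i => [|i [f [g [s [fZ gZ fgs]]]]].
  have [|f af] := @projective_lift _ _ _ _ (aug F) (aug P) (term_projective F 0%N).
    by move=> x; apply/aug_image/aug_image; exists x.
  have [|g ag] := @projective_lift _ _ _ _ (aug P) (aug F) (term_projective P 0%N).
    by move=> x; apply/aug_image/aug_image; exists x.
  have [x|s ds] := @projective_lift _ _ _ _ (idfun \- (g \o f)) (diff F 0%N)
                    (term_projective F 0%N).
    by apply/cycleP; rewrite /= linearB /= ag af subrr.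
  exists f, g, s; split=> x; rewrite /cycF /cycP /=.
  - by rewrite af.
  - by rewrite ag.
  - by rewrite ds.
have [x|f' df'] := @projective_lift _ _ _ _ (f \o diff F i) (diff P i)
                      (term_projective F i.+1).
  by apply/cycleP/fZ/cycle_diff.
have [x|g' dg'] := @projective_lift _ _ _ _ (g \o diff P i) (diff F i)
                      (term_projective P i.+1).
  by apply/cycleP/gZ/cycle_diff.
have [x|s' ds'] := @projective_lift _ _ _ _
    ((idfun \- (g' \o f')) \- (s \o diff F i)) (diff F i.+1) (term_projective F i.+1).
  apply/cycleP; rewrite /= !linearB /= dg' /= df' /= -fgs; last exact: cycle_diff.
  by rewrite subrr.
exists f', g', s'; split=> x; rewrite /cycF /cycP /=.
- by rewrite df' /= => ->; rewrite linear0.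
- by rewrite dg' /= => ->; rewrite linear0.
- by move=> dx; rewrite ds' /= dx linear0 subr0.
Qed.

(** If [P] vanishes in degree [n], then the lift of the identity to [P] is zero in
    that degree, and the homotopy turns every cocycle there into a coboundary. *)
Lemma ext_nonzero_length K n : ext_nonzero K F n -> (n <= l')%N.
Proof.
case: n => // n [phi phi_d phi_nc]; rewrite leqNgt; apply/negP => n_gt.
have [f [g [s [fZ _ fgs]]]] := comparison n; apply: phi_nc.
exists (phi \o s) => x /=.
have fd0 : f (diff F n x) = 0.
  have /cycleP[z <-] := fZ _ (cycle_diff x).
  by rewrite (term_length P n_gt z) linear0.
have /cycleP[z dz] : is_cycle (diff F) (aug F) (x - s (diff F n x)).
  rewrite /= linearB /= -fgs; last exact: cycle_diff.
  by rewrite fd0 linear0 subr0 subrr.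
by apply/eqP; rewrite -subr_eq0 -linearB /= -dz phi_d.
Qed.

End Comparison.

(** * Chain maps and mapping cones *)

Definition chain_lift (R : nzRingType) (M N : lmodType R) (I : M -> Prop)
    (J : N -> Prop) (l l' : nat) (F : resolution I l) (G : resolution J l')
    (f : {linear M -> N}) (h : forall i, {linear term F i -> term G i}) : Prop :=
  (forall x, aug G (h 0%N x) = f (aug F x)) /\
  (forall i x, diff G i (h i.+1 x) = h i (diff F i x)).

Lemma chain_lift_exists (R : nzRingType) (M N : lmodType R) (I : M -> Prop)
    (J : N -> Prop) (l l' : nat) (F : resolution I l) (G : resolution J l')
    (f : {linear M -> N}) :
  (forall x, I x -> J (f x)) -> exists h, @chain_lift R M N I J l l' F G f h.
Proof.
move=> fIJ.
(* Preservation of cycles is what allows the next component to be lifted. *)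
pose T i := {h : {linear term F i -> term G i} |
  forall x, is_cycle (diff F) (aug F) x -> is_cycle (diff G) (aug G) (h x)}.
have /cid[h0 h0E] : exists h : {linear term F 0%N -> term G 0%N},
    forall x, aug G (h x) = f (aug F x).
  have := @projective_lift _ _ _ _ (f \o aug F) (aug G) (term_projective F 0%N).
  by apply=> x; apply/aug_image/fIJ/aug_image; exists x.
have h0Z (x : term F 0%N) :
    is_cycle (diff F) (aug F) x -> is_cycle (diff G) (aug G) (h0 x).
  by rewrite /= h0E => ->; rewrite linear0.
have step i (h : T i) :
    {h' : T i.+1 | forall x, diff G i (sval h' x) = sval h (diff F i x)}.
  case: h => h hZ /=.
  have /cid[h' h'E] : exists h' : {linear term F i.+1 -> term G i.+1},
      forall x, diff G i (h' x) = h (diff F i x).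
    have := @projective_lift _ _ _ _ (h \o diff F i) (diff G i)
              (term_projective F i.+1).
    by apply=> x; apply/cycleP/hZ/cycle_diff.
  have h'Z (x : term F i.+1) :
      is_cycle (diff F) (aug F) x -> is_cycle (diff G) (aug G) (h' x).
    by rewrite /= h'E => ->; rewrite linear0.
  by exists (exist _ h' h'Z).
pose hs : forall i, T i := nat_rect T (exist _ h0 h0Z) (fun i h => sval (step i h)).
exists (fun i => sval (hs i)); split=> [x|i x]; first exact: h0E.
exact: (svalP (step i (hs i))).
Qed.

(** The mapping cone of a lift [h] of an injection [iota] with cokernel [pr]
    resolves the image of [pr]. *)
Section Cone.
Variables (R : nzRingType) (M N L : lmodType R) (I : M -> Prop) (J : N -> Prop).
Variables (l l' : nat) (F : resolution I l) (G : resolution J l').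
Variables (iota : {linear M -> N}) (pr : {linear N -> L}).
Variable h : forall i, {linear term F i -> term G i}.
Hypothesis h_lift : chain_lift iota h.
Hypothesis iota_inj : forall x, I x -> iota x = 0 -> x = 0.
Hypothesis pr_ker :
  forall y, J y -> (pr y = 0 <-> exists2 x, I x & iota x = y).
Hypothesis l'_le : (l' <= l.+1)%N.

Definition cone_term i : lmodType R :=
  match i with
  | 0 => term G 0%N
  | j.+1 => (term G j.+1 * term F j)%type
  end.

Lemma cone_diff0_linear : linear (fun z : cone_term 1 =>
  diff G 0 z.1 + h 0%N z.2 : cone_term 0).
Proof. by move=> a y z; rewrite /= !linearP /= scalerDr addrACA. Qed.

Lemma cone_diffS_linear j : linear (fun z : cone_term j.+2 =>
  (diff G j.+1 z.1 + h j.+1 z.2, - diff F j z.2) : cone_term j.+1).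
Proof.
move=> a y z; apply: injective_projections => /=.
  by rewrite !linearP /= scalerDr addrACA.
by rewrite linearP /= opprD scalerN.
Qed.

Definition cone_diff i : {linear cone_term i.+1 -> cone_term i} :=
  match i with
  | 0 => mk_linear cone_diff0_linear
  | j.+1 => mk_linear (@cone_diffS_linear j)
  end.

Definition cone_aug : {linear cone_term 0 -> L} := (pr \o aug G : {linear _ -> _}).

(** In degree 0 the second condition is not imposed by the differential; it follows
    from the first one since [iota] is injective. *)
Lemma cone_cycle i (z : cone_term i.+1) :
  cone_diff i z = 0 <->
  diff G i z.1 + h i z.2 = 0 /\ is_cycle (diff F) (aug F) z.2.
Proof.
case: i z => [|i] z /=; split.
- move=> dz; split=> //; apply: iota_inj; first by apply/aug_image; exists z.2.
  rewrite -h_lift.1 -[RHS](linear0 (aug G)) -dz linearD /=.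
  by rewrite (cycle_diff z.1 : aug G _ = 0) add0r.
- by case.
- by case=> -> /eqP; rewrite oppr_eq0 => /eqP.
- by case=> -> ->; rewrite oppr0.
Qed.

Lemma cone_cycleP i (x : cone_term i) :
  is_cycle cone_diff cone_aug x <-> exists z, cone_diff i z = x.
Proof.
case: i x => [x|i x] /=.
  have Jx : J (aug G x) by apply/aug_image; exists x.
  split=> [/(pr_ker Jx)[y /(aug_image F)[f <-] iy] | [[g f] /= <-]].
    have /cycleP[g dg] : is_cycle (diff G) (aug G) (x - h 0%N f).
      by rewrite /= linearB /= h_lift.1 iy subrr.
    by exists (g, f); rewrite /= dg subrK.
  rewrite linearD /= (cycle_diff g : aug G _ = 0) add0r h_lift.1.
  apply/pr_ker; last by exists (aug F f) => //; apply/aug_image; exists f.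
  by rewrite -h_lift.1; apply/aug_image; exists (h 0%N f).
case: x => g f; split=> [/cone_cycle[/= dgf /cycleP[f' df']]|[[g' f'] <-]].
  have /cycleP[g' dg'] : is_cycle (diff G) (aug G) (g + h i.+1 f').
    by rewrite /= linearD /= h_lift.2 df'.
  exists (g', - f'); rewrite /= dg' !linearN /= df' opprK.
  by rewrite addrK.
apply/cone_cycle; split=> /=; last by apply/cycleP; exists (- f'); rewrite linearN.
by rewrite linearD linearN /= diff0 add0r h_lift.2 subrr.
Qed.

Lemma cone_projective i : projective (cone_term i).
Proof.
case: i => [|i]; first exact: (term_projective G 0%N).
exact: projective_prod (term_projective G i.+1) (term_projective F i).
Qed.

Lemma cone_image y :
  (exists2 x, J x & pr x = y) <-> exists z, cone_aug z = y.
Proof.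
split=> [[x /(aug_image G)[z <-] <-]|[z <-]]; first by exists z.
by exists (aug G z) => //; apply/aug_image; exists z.
Qed.

Lemma cone_length i : (l.+1 < i)%N -> forall x : cone_term i, x = 0.
Proof.
case: i => // i; rewrite ltnS => i_gt [g f].
rewrite (term_length F i_gt f).
by rewrite (term_length G (leq_ltn_trans l'_le (i_gt : (l.+1 < i.+1)%N)) g).
Qed.

Definition cone : resolution (fun y => exists2 x, J x & pr x = y) l.+1 :=
  Resolution cone_projective cone_image cone_cycleP cone_length.

(** The connecting map [Ext ^ n (I) -> Ext ^ (n+1)] of the cone sends a cocycle to
    its composite with the second projection.  Its kernel is the image of the map
    induced by [h], which is zero by hypothesis. *)
Lemma cone_ext_nonzero (K : lmodType R) n :
    (forall i (phi : {linear term G i -> K}) x, phi (h i x) = 0) ->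
  ext_nonzero K F n -> ext_nonzero K cone n.+1.
Proof.
move=> h_zero [phi phi_d phi_nc]; exists (phi \o snd : {linear _ -> _}).
  by case=> g f; rewrite /= linearN /= phi_d oppr0.
case=> psi psiE; apply: phi_nc; case: n phi phi_d psi psiE => [|n] phi phi_d psi psiE /=.
  by move=> f; have := psiE (0, f); rewrite /= linear0 add0r h_zero.
have psi1L : linear (fun g => psi (g, 0)).
  move=> a x y; rewrite -linearP; congr (psi _).
  by apply: injective_projections => //=; rewrite scaler0 addr0.
have psi2L : linear (fun f => psi (0, - f)).
  move=> a x y; rewrite -linearP; congr (psi _).
  apply: injective_projections => /=; first by rewrite scaler0 addr0.
  by rewrite opprD scalerN.
exists (mk_linear psi2L) => f /=.
have := psiE (0, f); rewrite /= linear0 add0r => ->.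
have := h_zero _ (mk_linear psi1L) f => /= psih0.
rewrite -[RHS]add0r -psih0 -linearD; congr (psi _).
by apply: injective_projections; rewrite /= ?addr0 ?add0r.
Qed.

End Cone.

(** * Resolutions of products, of the ring and of quotients *)

Section Product.
Variable R : nzRingType.

Section PairMap.
Variables (M M' N N' : lmodType R).
Variables (f : {linear M -> M'}) (g : {linear N -> N'}).

Lemma pair_map_linear : linear (fun z : M * N => (f z.1, g z.2)).
Proof. by move=> a x y; apply: injective_projections; rewrite /= linearP. Qed.

Definition pair_map : {linear (M * N)%type -> (M' * N')%type} :=
  mk_linear pair_map_linear.

End PairMap.

Variables (M N : lmodType R) (I : M -> Prop) (J : N -> Prop) (l l' : nat).
Variables (F : resolution I l) (G : resolution J l').

Let T i : lmodType R := (term F i * term G i)%type.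
Let d i : {linear T i.+1 -> T i} := pair_map (diff F i) (diff G i).
Let e : {linear T 0 -> (M * N)%type} := pair_map (aug F) (aug G).

Lemma product_image y : I y.1 /\ J y.2 <-> exists x, e x = y.
Proof.
case: y => y z; split=> /= [[/(aug_image F)[f <-] /(aug_image G)[g <-]]|].
  by exists (f, g).
by case=> -[f g] [<- <-]; split; apply/aug_image; [exists f | exists g].
Qed.

Lemma product_cycleP i (x : T i) : is_cycle d e x <-> exists z, d i z = x.
Proof.
have -> : is_cycle d e x <->
    is_cycle (diff F) (aug F) x.1 /\ is_cycle (diff G) (aug G) x.2.
  by case: i x => [|i] [x y] /=; split=> [[-> ->]|[-> ->]].
case: x => x y; split=> /= [[/cycleP[f <-] /cycleP[g <-]]|]; first by exists (f, g).
by case=> -[f g] [<- <-]; split; apply: cycle_diff.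
Qed.

Lemma product_length i : (maxn l l' < i)%N -> forall x : T i, x = 0.
Proof.
rewrite gtn_max => /andP[li l'i] [x y].
by rewrite (term_length F li x) (term_length G l'i y).
Qed.

Definition product_resolution :
    resolution (fun y : M * N => I y.1 /\ J y.2) (maxn l l') :=
  Resolution
    (fun i => projective_prod (term_projective F i) (term_projective G i))
    product_image product_cycleP product_length.

End Product.

Section Regular.
Variable R : nzRingType.

Let T i : lmodType R := if i is 0 then R^o : lmodType R else 'rV[R]_0.

Lemma regular_diff_linear i : linear (fun _ : T i.+1 => 0 : T i).
Proof. by move=> a x y; rewrite scaler0 addr0. Qed.

Let d i : {linear T i.+1 -> T i} := mk_linear (@regular_diff_linear i).

Lemma regular_term_eq0 i : (0 < i)%N -> forall x : T i, x = 0.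
Proof. by case: i => // i _ x; apply/rowP => -[]. Qed.

Lemma regular_projective i : projective (T i).
Proof.
case: i => [|i]; first exact: projective_regular.
exact/projective_trivial/regular_term_eq0.
Qed.

Let e : {linear T 0 -> R^o} := idfun.

Lemma regular_image (I : R^o -> Prop) :
  (forall x, I x) -> forall y, I y <-> exists x, e x = y.
Proof. by move=> I_all y; split=> // _; exists y. Qed.

Lemma regular_cycleP i (x : T i) :
  is_cycle d e x <-> exists z, d i z = x.
Proof.
case: i x => [|i] x /=; first by split=> [->|[_ <-]//]; exists 0.
by split=> // _; exists 0; rewrite [RHS]regular_term_eq0.
Qed.

Definition regular_resolution (I : R^o -> Prop) (I_all : forall x, I x) :
    resolution I 0 :=
  Resolution regular_projective (regular_image I_all) regular_cycleP
    regular_term_eq0.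

Lemma regular_ext_nonzero (I : R^o -> Prop) (I_all : forall x, I x)
    (K : lmodType R) :
  (exists x : K, x != 0) -> ext_nonzero K (regular_resolution I_all) 0.
Proof.
case=> k k_neq0.
have phiL : linear (fun r : R^o => (r : R) *: k).
  by move=> a r s; rewrite scalerDl scalerA.
exists (mk_linear phiL); first by move=> x; rewrite /= scale0r.
by move=> /(_ (1 : R)) /eqP; rewrite /= scale1r (negPf k_neq0).
Qed.

End Regular.

(** A resolution of [U] is continued by the inclusion of [U] in [V]; this moves
    Ext classes of positive degree one degree up. *)
Section Quotient.
Variables (R : nzRingType) (V : lmodType R) (U : submodClosed V).

Local Notation Q := (quot_mod U).

Lemma quot_pi_linear : linear (\pi_Q : V -> Q)%qT.
Proof.
move=> a x y; rewrite (raddfD \pi_Q)%qT; congr (_ + _).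
by rewrite -[LHS](quot_scale_pi U a x).
Qed.

Definition quot_pi : {linear V -> Q} := mk_linear quot_pi_linear.

Lemma quot_pi_surj y : exists x, quot_pi x = y.
Proof. by elim/quotW: y => x; exists x. Qed.

Lemma quot_pi_eq0 x : quot_pi x = 0 <-> x \in U.
Proof.
rewrite -[x in x \in U]subr0 -[_ \in U]/(_ \in submod_pred U).
rewrite Quotient.idealrBE -[0 in X in X <-> _](linear0 quot_pi).
by split=> /eqP.
Qed.

Variables (l : nat) (F : resolution (fun x => x \in U) l).
Hypothesis projV : projective V.

Let T i : lmodType R := if i is j.+1 then term F j else V.

Let d i : {linear T i.+1 -> T i} :=
  match i with 0 => aug F | j.+1 => diff F j end.

Lemma quot_term_projective i : projective (T i).
Proof. by case: i => [|i] //; apply: term_projective. Qed.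

Lemma quot_image y : True <-> exists x : T 0, quot_pi x = y.
Proof. by split=> // _; apply: quot_pi_surj. Qed.

Lemma quot_cycleP i (x : T i) : is_cycle d quot_pi x <-> exists z, d i z = x.
Proof.
case: i x => [|i] x.
  by rewrite -(aug_image F x) -quot_pi_eq0.
by rewrite -(cycleP F); case: i x.
Qed.

Lemma quot_length i : (l.+1 < i)%N -> forall x : T i, x = 0.
Proof. by case: i => // i; apply: (term_length F). Qed.

Definition quot_resolution : resolution (fun _ : Q => True) l.+1 :=
  Resolution quot_term_projective quot_image quot_cycleP quot_length.

End Quotient.

Section ProjResolution.
Variables (R : nzRingType) (M : lmodType R) (l : nat).

Lemma pd_leP : pd_le M l <-> inhabited (resolution (fun _ : M => True) l).
Proof.
split=> -[P]; constructor.
  refine (@Resolution _ _ _ _ _ (res_diff P) (res_aug P)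
    (@res_projective _ _ _ P) _ _ (res_length (p := P))).
    by move=> y; split=> // _; apply: res_aug_surj.
  by case=> [|i] x; [apply: res_exact0 | apply: res_exact].
refine (@ProjResolution _ _ _ _ (diff P) (aug P)
  (term_projective P) _ _ _ (term_length P)).
- by move=> y; apply/(aug_image P).
- exact: (cycleP P (i := 0%N)).
- by move=> i; exact: (cycleP P (i := i.+1)).
Qed.

End ProjResolution.

(** * Powers of the ideals attached to two sequences of ring elements *)

Section Powers.
Variables (R : idomainType) (u v : nat -> R).

Definition uprod c : R := \prod_(j < c) u j.

Lemma uprodS c : uprod c.+1 = u c * uprod c.
Proof. by rewrite /uprod big_ord_recr mulrC. Qed.

(** [chain_pow c t] is the [t]-th power of the ideal generated by the products
    [u 0 ... u (a-1) v a ... v (c-1)] for [a <= c].  It is defined by the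
    decomposition that yields the exact sequences; [ideal_powE] relates it to powers
    generated by products. *)
Fixpoint chain_pow c : nat -> R -> Prop :=
  if c is c'.+1 then
    fix pow t := if t is t'.+1 then fun x =>
      exists a b : R, [/\ chain_pow c' t'.+1 a, pow t' b
        & x = v c' ^+ t'.+1 * a + uprod c * b]
    else fun=> True
  else fun _ _ => True.

Lemma chain_pow0 c x : chain_pow c 0 x.
Proof. by case: c. Qed.

Lemma chain_powE c t x : chain_pow c.+1 t.+1 x <->
  exists a b : R, [/\ chain_pow c t.+1 a, chain_pow c.+1 t b
    & x = v c ^+ t.+1 * a + uprod c.+1 * b].
Proof. by []. Qed.

Lemma chain_powD c t x y :
  chain_pow c t x -> chain_pow c t y -> chain_pow c t (x + y).
Proof.
elim: c t x y => // c IHc; elim=> // t IHt x y.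
move=> /chain_powE[a [b [Ia Ib ->]]] /chain_powE[a' [b' [Ia' Ib' ->]]].
exists (a + a'), (b + b'); split; [exact: IHc | exact: IHt | ring].
Qed.

Lemma chain_powM c t r x : chain_pow c t x -> chain_pow c t (r * x).
Proof.
elim: c t x => // c IHc; elim=> // t IHt x /chain_powE[a [b [Ia Ib ->]]].
exists (r * a), (r * b); split; [exact: IHc | exact: IHt | ring].
Qed.

Lemma chain_pow_zero c t : chain_pow c t 0.
Proof.
elim: c t => // c IHc; elim=> // t IHt.
by exists 0, 0; split=> //; ring.
Qed.

Lemma chain_pow_uprod c t x : chain_pow c t x -> chain_pow c t.+1 (uprod c * x).
Proof.
case: c => // c Ix; exists 0, x; split=> //; last by ring.
exact: (chain_pow_zero _ _).
Qed.

Lemma chain_pow_v c t x : chain_pow c t x -> chain_pow c.+1 t (v c ^+ t * x).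
Proof.
case: t => // t Ix; exists x, 0; split=> //; last by ring.
exact: (chain_pow_zero c.+1 t).
Qed.

(** The generator [uprod c.+1 = u c * uprod c] lies in the ideal of index [c]
    already. *)
Lemma chain_pow_sub c t x : chain_pow c.+1 t x -> chain_pow c t x.
Proof.
elim: t x => [|t IHt] x; first by move=> _; apply: chain_pow0.
case/chain_powE=> a [b [Ia /IHt Ib ->]].
apply: chain_powD; first exact: chain_powM.
by rewrite uprodS -mulrA; apply/chain_powM/chain_pow_uprod.
Qed.

(** Write [x = v c * a + uprod c.+1 * b].  The second summand raises the power by
    definition.  The first one is multiplied with the two summands of [y]: induction
    on [c] handles [v c ^ t * a'], induction on [t] handles [uprod c.+1 * b']. *)
Lemma chain_pow1M c t x y :
  chain_pow c 1 x -> chain_pow c t y -> chain_pow c t.+1 (x * y).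
Proof.
elim: c t x y => // c IHc t x y /chain_powE[a [b [Ia _ ->]]] Iy.
rewrite mulrDl -(mulrA (uprod _)); apply: chain_powD; last first.
  exact/chain_pow_uprod/chain_powM.
rewrite expr1; elim: t y Iy => [|t IHt] y.
  move=> _; rewrite -mulrA; apply: (chain_pow_v (t := 1)).
  by rewrite mulrC; apply: chain_powM.
case/chain_powE=> a' [b' [Ia' Ib' ->]].
exists (a * a'), (v c * a * b'); split; [exact: IHc | exact: IHt | rewrite !exprS; ring].
Qed.

(** [D c] stands for the division by a monomial [v c] that shares no variable with
    [u 0 ... u c] and [v 0 ... v (c-1)].  It replaces arguments about regular
    sequences. *)
Variables (d : nat) (D : nat -> R -> R).
Hypothesis u_neq0 : forall c, (c < d)%N -> u c != 0.
Hypothesis DD : forall c, {morph D c : x y / x + y}.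
Hypothesis Dv : forall c, (c < d)%N -> cancel ( *%R (v c)) (D c).
Hypothesis DuM : forall c j x, (j <= c < d)%N -> D c (u j * x) = u j * D c x.
Hypothesis DvM : forall c j x, (j < c < d)%N -> D c (v j * x) = v j * D c x.

Lemma uprod_neq0 c : (c <= d)%N -> uprod c != 0.
Proof.
by move=> cd; apply/prodf_neq0 => j _; apply/u_neq0/(leq_trans _ cd).
Qed.

Lemma D_uprod c i x : (i <= c.+1)%N -> (c < d)%N ->
  D c (uprod i * x) = uprod i * D c x.
Proof.
move=> ic cd; elim: i ic x => [|i IHi] ic x; first by rewrite /uprod big_ord0 !mul1r.
by rewrite !uprodS -!mulrA DuM ?IHi ?(ltnW ic) // -ltnS ic.
Qed.

Lemma D_vX c j n x : (j < c < d)%N -> D c (v j ^+ n * x) = v j ^+ n * D c x.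
Proof.
move=> jcd; elim: n x => [|n IHn] x; first by rewrite !mul1r.
by rewrite !exprS -!mulrA DvM // IHn.
Qed.

Lemma chain_pow_D c i t x :
  (i <= c < d)%N -> chain_pow i t x -> chain_pow i t (D c x).
Proof.
elim: i t x => // i IHi; elim=> // t IHt x icd /chain_powE[a [b [Ia Ib ->]]].
have /andP[ic cd] := icd.
exists (D c a), (D c b); split; [| exact: IHt |].
  by apply: IHi => //; rewrite (ltnW ic).
by rewrite DD D_vX // D_uprod // ltnW.
Qed.

(** Applying [D c] repeatedly to the relation solves it for [a] as a multiple of
    [uprod c.+1]; the quotient stays in the ideal of index [c], which contains [b]
    and is stable under [D c]. *)
Lemma chain_pow_syzygy c t a b : (c < d)%N ->
    chain_pow c t.+1 a -> chain_pow c.+1 t b ->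
    v c ^+ t.+1 * a + uprod c.+1 * b = 0 ->
  exists z, [/\ chain_pow c t z, a = uprod c.+1 * z & b = - (v c ^+ t.+1 * z)].
Proof.
move=> cd Ia Ib ab0.
have DvX n x : iter n (D c) (v c ^+ n * x) = x.
  elim: n x => [|n IHn] x; first by rewrite mul1r.
  by rewrite iterSr exprS -mulrA Dv // IHn.
have DU n x : iter n (D c) (uprod c.+1 * x) = uprod c.+1 * iter n (D c) x.
  by elim: n => //= n ->; rewrite D_uprod.
have IN n x : chain_pow c t x -> chain_pow c t (iter n (D c) x).
  by move=> Ix; elim: n => //= n; apply: chain_pow_D; rewrite leqnn.
have aE : v c ^+ t.+1 * a = uprod c.+1 * - b.
  by rewrite mulrN; apply/eqP; rewrite -addr_eq0 ab0.
have {}aE' : a = uprod c.+1 * iter t.+1 (D c) (- b) by rewrite -DU -aE DvX.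
exists (iter t.+1 (D c) (- b)); split=> //.
  by apply: IN; rewrite -mulN1r; apply/chain_powM/chain_pow_sub.
apply: (mulfI (uprod_neq0 cd)); move: aE; rewrite {1}aE' => aE.
by rewrite mulrN mulrCA aE; ring.
Qed.

Variable K : lmodType R.
Hypothesis uK : forall c (k : K), (c < d)%N -> u c *: k = 0.
Hypothesis vK : forall c (k : K), (c < d)%N -> v c *: k = 0.
Hypothesis K_neq0 : exists k : K, k != 0.

(** The projective dimension of [I] is exactly [l], detected by [K]. *)
Definition has_ext_resolution (I : R^o -> Prop) l : Prop :=
  exists F : resolution I l, ext_nonzero K F l.

Lemma mulmap_linear (r : R) : linear (fun x : R^o => r * x : R^o).
Proof. by move=> a x y; rewrite mulrDr -[a *: x]/(a * x) mulrCA. Qed.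

(** The ideals of index [(c, t)], [(c, t+1)], [(c+1, t)] and [(c+1, t+1)] are related
    by a short exact sequence whose left map is [(uprod c.+1, - v c ^ t.+1)].  Each
    component has a factor [u c] or [v c], so its lift can be taken with the
    same factor and is killed by every map to [K].  The middle term has a
    resolution of length at most [(minn c t).+1] and contributes nothing else. *)
Lemma chain_pow_resolution c t :
  (c <= d)%N -> has_ext_resolution (chain_pow c t) (minn c t).
Proof.
have triv (I : R^o -> Prop) : (forall x, I x) -> has_ext_resolution I 0.
  by move=> I_all; exists (regular_resolution I_all); apply: regular_ext_nonzero.
elim: c t => [|c IHc] t cd; first by rewrite min0n; apply: triv.
elim: t => [|t [G2 _]]; first by rewrite minn0; apply: triv.
have [F extF] := IHc t (ltnW cd).
have [G1 _] := IHc t.+1 (ltnW cd).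
have [|ha ha_lift] := @chain_lift_exists _ _ _ _ _ _ _ F G1
  (mk_linear (mulmap_linear (uprod c))).
  by move=> x; apply: chain_pow_uprod.
have [|hb hb_lift] := @chain_lift_exists _ _ _ _ _ _ _ F G2
  (mk_linear (mulmap_linear (v c ^+ t))).
  by move=> x; apply: chain_pow_v.
pose G := product_resolution G1 G2.
have hL i : linear (fun x : term F i => (u c *: ha i x, - v c *: hb i x) : term G i).
  move=> a x y; apply: injective_projections => /=.
    by rewrite linearP scalerDr !scalerA mulrC.
  by rewrite linearP scalerDr !scalerA mulrC.
pose h i : {linear term F i -> term G i} := mk_linear (hL i).
have iotaL : linear (fun z : R^o => (uprod c.+1 * z, - (v c ^+ t.+1 * z)) : R^o * R^o).
  move=> a x y; apply: injective_projections => /=.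
    by rewrite mulrDr -[a *: x]/(a * x) mulrCA.
  by rewrite mulrDr -[a *: x]/(a * x) mulrCA opprD -mulrN.
have prL : linear (fun z : R^o * R^o => v c ^+ t.+1 * z.1 + uprod c.+1 * z.2 : R^o).
  move=> a [x1 x2] [y1 y2] /=.
  by rewrite -![_ *: _]/(_ * _); ring.
have h_lift : chain_lift (F := F) (G := G) (mk_linear iotaL) h.
  split=> [x|i x]; apply: injective_projections => /=.
  - by rewrite linearZ /= ha_lift.1 /= uprodS -[_ *: _]/(_ * _) mulrA.
  - by rewrite linearZ /= hb_lift.1 /= exprS scaleNr -[_ *: _]/(_ * _) mulrA.
  - by rewrite linearZ /= ha_lift.2.
  - by rewrite linearZ /= hb_lift.2.
have iota_inj x : chain_pow c t x -> mk_linear iotaL x = 0 -> x = 0.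
  by move=> _ [/eqP]; rewrite mulf_eq0 (negPf (uprod_neq0 cd)) => /eqP.
have pr_ker y : chain_pow c t.+1 y.1 /\ chain_pow c.+1 t y.2 ->
    mk_linear prL y = 0 <-> exists2 x, chain_pow c t x & mk_linear iotaL x = y.
  case: y => a b [/= Ia Ib]; split=> [/(chain_pow_syzygy cd Ia Ib)|].
    by case=> z [Iz -> ->]; exists z.
  by case=> z _ [<- <-]; ring.
have len : (maxn (minn c t.+1) (minn c.+1 t) <= (minn c t).+1)%N.
  by rewrite geq_max -!minnSS !leq_min !geq_min !leqnn !leqnSn ?orbT.
have -> : chain_pow c.+1 t.+1 = fun y : R^o => exists2 x : R^o * R^o,
    chain_pow c t.+1 x.1 /\ chain_pow c.+1 t x.2 & mk_linear prL x = y.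
  apply/funext => y; apply/propext; split.
    by case/chain_powE=> a [b [Ia Ib ->]]; exists (a, b).
  by case=> -[a b] [/= Ia Ib] <-; exists a, b.
rewrite minnSS; exists (cone h_lift iota_inj pr_ker len).
apply: cone_ext_nonzero extF => i phi x.
have -> : h i x = u c *: (ha i x, 0) + v c *: (0, - hb i x) :> term G i.
  by apply: injective_projections; rewrite /= ?scaler0 ?addr0 ?add0r // scaleNr scalerN.
by rewrite linearD !linearZ /= uK // vK // addr0.
Qed.

Variable J : set R.
Hypothesis J_sub : forall x, J x -> chain_pow d 1 x.

Definition vprod c : R := \prod_(c <= j < d) v j.

Hypothesis gen_J : forall c, (c <= d)%N -> J (uprod c * vprod c).

Lemma vprodS c : (c < d)%N -> vprod c = v c * vprod c.+1.
Proof. by move=> cd; rewrite /vprod big_ltn. Qed.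

Lemma ideal_pow_sub t x : x \in ideal_pow J t -> chain_pow d t x.
Proof.
case/asboolP=> s sJ ->; rewrite big_seq; elim/big_rec: _ => [|p y /sJ[w wJ ->] Iy].
  exact: (chain_pow_zero _ _).
apply: chain_powD Iy; apply: chain_powM.
elim: t w wJ {sJ s p} => [|t IHt] w wJ; first exact: chain_pow0.
rewrite big_ord_recl; apply: chain_pow1M; first exact/J_sub.
case/tupleP: w wJ => x0 w wJ.
have -> : \prod_(i < t) tnth [tuple of x0 :: w] (lift ord0 i) = \prod_(i < t) tnth w i.
  by apply: eq_bigr => i _; rewrite tnthS.
by apply: IHt => i; have := wJ (lift ord0 i); rewrite tnthS.
Qed.

Lemma ideal_powD t x y :
  x \in ideal_pow J t -> y \in ideal_pow J t -> x + y \in ideal_pow J t.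
Proof. exact: (rpredD (S := ideal_pow J t)). Qed.

Lemma ideal_pow0 x : x \in ideal_pow J 0.
Proof.
apply/asboolP; exists [:: (x, 1)]; last by rewrite big_seq1 mulr1.
by move=> p; rewrite inE => /eqP->; exists [tuple]; [case | rewrite big_ord0].
Qed.

Lemma ideal_powM t x y : J x -> y \in ideal_pow J t -> x * y \in ideal_pow J t.+1.
Proof.
move=> Jx /asboolP[s sJ ->]; apply/asboolP.
exists [seq (p.1, x * p.2) | p <- s].
  move=> _ /mapP[p /sJ[w wJ pE] ->]; exists [tuple of x :: w].
    by move=> i; case: (unliftP ord0 i) => [j|] ->; rewrite ?tnthS // tnth0.
  rewrite big_ord_recl tnth0 /= pE; congr (_ * _).
  by apply: eq_bigr => i _; rewrite tnthS.
by rewrite big_map mulr_sumr; apply: eq_bigr => p _; rewrite mulrCA.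
Qed.

(** Multiplying by [vprod c ^ t] completes products of the first [c] blocks to
    products of all [d] blocks, i.e. to products of the generators of [J]. *)
Lemma chain_pow_scaled c t x : (c <= d)%N ->
  chain_pow c t x -> vprod c ^+ t * x \in ideal_pow J t.
Proof.
elim: c t x => [|c IHc]; elim=> [|t IHt] x cd; try by move=> _; apply: ideal_pow0.
  move=> _; rewrite exprS -mulrA; apply: ideal_powM; last exact: IHt.
  by have := gen_J (leq0n d); rewrite /uprod big_ord0 mul1r.
case/chain_powE=> a [b [Ia Ib ->]]; rewrite mulrDr; apply: ideal_powD.
  rewrite mulrA -exprMn [_ * v c]mulrC -vprodS //.
  exact: (IHc t.+1 a (ltnW cd) Ia).
rewrite exprS mulrCA -!mulrA mulrA.
by apply: ideal_powM; [exact: gen_J | exact: (IHt b cd Ib)].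
Qed.

Lemma ideal_powE t x : x \in ideal_pow J t <-> chain_pow d t x.
Proof.
split; first exact: ideal_pow_sub.
move/(chain_pow_scaled (leqnn d)).
by rewrite /vprod big_geq // expr1n mul1r.
Qed.

Lemma pd_quot_pow t : (1 <= t)%N -> (1 <= d)%N ->
  pd_eq (quot_mod (ideal_pow J t)) (1 + minn t d).
Proof.
move=> t_gt0 d_gt0; rewrite minnC add1n.
have [F extF] : has_ext_resolution (fun x => x \in ideal_pow J t) (minn d t).
  have -> : (fun x : R^o => x \in ideal_pow J t : Prop) = chain_pow d t.
    by apply/funext => x; apply/propext/ideal_powE.
  exact: chain_pow_resolution.
pose Q := quot_resolution F (@projective_regular R).
split; first by apply/pd_leP; constructor; exact: Q.
move=> l' /pd_leP[P]; apply: (ext_nonzero_length (F := Q) P (K := K)).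
have : (0 < minn d t)%N by rewrite leq_min d_gt0.
(* In positive degrees [Q] is [F] shifted by one, by conversion. *)
by case: (minn d t) F extF @Q.
Qed.

End Powers.

(** * Division by a monomial *)

Section MonomialDivision.
Variables (k : comNzRingType) (p : nat).
Implicit Types (f g : {mpoly k[p]}) (e m : 'X_{1..p}).

Lemma mcoeffXM e f m :
  ('X_[e] * f)@_m = if (e <= m)%MM then f@_(m - e) else 0.
Proof.
rewrite mulrC; case: ifPn => [em|em]; first by rewrite -(mcoeffMX f e) addmC submK.
apply/eqP; rewrite mcoeff_eq0 (perm_mem (msuppMX f e)).
by apply: contra em => /mapP[m' _ ->]; apply: lem_addr.
Qed.

(** Dropping the monomials that ['X_[e]] does not divide makes the division a total
    additive map. *)
Definition mdivX e f : {mpoly k[p]} :=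
  \sum_(m <- msupp f | (e <= m)%MM) f@_m *: 'X_[m - e].

Lemma mcoeff_mdivX e f m : (mdivX e f)@_m = f@_(m + e).
Proof.
rewrite [in RHS](mpolyE f) /mdivX big_mkcond /= !raddf_sum /=.
apply: eq_bigr => m' _; case: ifPn => [em|em]; rewrite ?mcoeff0 !mcoeffZ !mcoeffX.
  congr (_ * (_ : bool)%:R); apply/eqP/eqP => [<-|->]; first by rewrite submK.
  by rewrite addmK.
by case: eqP em => [->|_]; rewrite ?lem_addl // mulr0.
Qed.

Lemma mdivX_is_additive e : {morph mdivX e : f g / f + g}.
Proof. by move=> f g; apply/mpolyP => m; rewrite !(mcoeff_mdivX, mcoeffD). Qed.

Lemma mdivXK e : cancel ( *%R 'X_[e]) (mdivX e).
Proof.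
by move=> f; apply/mpolyP => m; rewrite mcoeff_mdivX mcoeffXM lem_addl addmK.
Qed.

Lemma mdivX_coprime e e' f : (forall i, e i = 0 \/ e' i = 0)%N ->
  mdivX e ('X_[e'] * f) = 'X_[e'] * mdivX e f.
Proof.
move=> ee'; apply/mpolyP => m; rewrite mcoeff_mdivX !mcoeffXM.
have -> : (e' <= m + e)%MM = (e' <= m)%MM.
  by apply/mnm_lepP/mnm_lepP => le i; have := le i; rewrite mnmDE; case: (ee' i) => ->; lia.
case: ifPn => // /mnm_lepP e'm; rewrite mcoeff_mdivX; congr (_@__).
by apply/mnmP => i; rewrite !(mnmBE, mnmDE); have := e'm i; lia.
Qed.

End MonomialDivision.

(** * The residue field as a module *)

Section ResidueField.
Variables (k : fieldType) (p : nat).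

(** A copy of [k] on which polynomials act through their constant coefficients: the
    quotient of the polynomial ring by the ideal of all variables. *)
Definition residue : Type := k.
HB.instance Definition _ := GRing.Zmodule.on residue.

Definition residue_scale (f : {mpoly k[p]}) (a : residue) : residue := f@_0 * a.

Lemma residue_scaleA f g a :
  residue_scale f (residue_scale g a) = residue_scale (f * g) a.
Proof. by rewrite /residue_scale rmorphM mulrA. Qed.

Lemma residue_scale1 : left_id 1 residue_scale.
Proof. by move=> a; rewrite /residue_scale rmorph1 mul1r. Qed.

Lemma residue_scaleDr : right_distributive residue_scale +%R.
Proof. by move=> f a b; rewrite /residue_scale mulrDr. Qed.

Lemma residue_scaleDl a : {morph residue_scale^~ a : f g / f + g}.
Proof. by move=> f g; rewrite /residue_scale mcoeffD mulrDl. Qed.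

HB.instance Definition _ := GRing.Zmodule_isLmodule.Build {mpoly k[p]} residue
  residue_scaleA residue_scale1 residue_scaleDr residue_scaleDl.

Lemma residueX_eq0 (e : 'X_{1..p}) i (a : residue) :
  e i != 0%N -> 'X_[e] *: a = 0.
Proof.
move=> ei; rewrite /GRing.scale /= /residue_scale mcoeffX.
by have [e0|_] := eqVneq e 0%MM; rewrite ?mul0r //; rewrite e0 mnm0E in ei.
Qed.

End ResidueField.

(** * Vertex covers of Ferrers graphs *)

Section IdealGen.
Variable R : comNzRingType.

Lemma mem_ideal_gen (A : set R) x : A x -> x \in ideal_gen A.
Proof.
move=> Ax; apply/asboolP; exists [:: (1, x)]; last by rewrite big_seq1 mul1r.
by move=> q; rewrite inE => /eqP->.
Qed.

Lemma ideal_genM (A : set R) r x : x \in ideal_gen A -> r * x \in ideal_gen A.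
Proof. exact: (ideal_gen_scaler_closed (A := A)). Qed.

End IdealGen.

Section Ferrers.
Variables (k : fieldType) (lam : seq nat).
Hypothesis lam_part : is_partition lam.

Local Notation n := (size lam).
Local Notation m := (head 0%N lam).
Local Notation S := {mpoly k[n + m]}.
Local Notation d := (distinct_parts lam).

(** The distinct parts in decreasing order, followed by 0: the default value makes
    [part (distinct_parts lam)] the lower end of the last block of columns. *)
Definition part c := nth 0%N (undup lam) c.

Lemma part_gt0 c : (c < d)%N -> (0 < part c)%N.
Proof.
case/and3P: lam_part => _ _ /allP lam_gt0 cd.
by apply: lam_gt0; rewrite -mem_undup mem_nth.
Qed.

Lemma part_lt a b : (a < b <= d)%N -> (part b < part a)%N.
Proof.
case/andP=> ab; rewrite leq_eqVlt => /orP[/eqP bd|bd].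
  by rewrite {1}/part nth_default ?bd // part_gt0 // -bd.
have gtn_undup : sorted gtn (undup lam).
  rewrite gtn_sorted_uniq_geq undup_uniq.
  apply: subseq_sorted (undup_subseq lam) _; last by case/and3P: lam_part.
  by move=> x y z xy /leq_trans; apply.
apply: (sorted_ltn_nth (leT := gtn) _ 0%N gtn_undup) => //; rewrite ?inE //.
- by move=> x y z xy /ltn_trans; apply.
- exact: ltn_trans bd.
Qed.

Lemma part_le a b : (a <= b <= d)%N -> (part b <= part a)%N.
Proof.
case/andP; rewrite leq_eqVlt => /orP[/eqP->//|ab bd].
by apply/ltnW/part_lt; rewrite ab.
Qed.

Lemma part_d : part d = 0%N.
Proof. exact: nth_default. Qed.

Lemma part_inj a b : (a < d)%N -> (b < d)%N -> part a = part b -> a = b.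
Proof. by move=> ad bd /eqP; rewrite nth_uniq ?undup_uniq // => /eqP. Qed.

Lemma part_row c : (c < d)%N -> exists i : 'I_n, nth 0%N lam i = part c.
Proof.
move=> cd; have : part c \in lam by rewrite -mem_undup mem_nth.
by case/(nthP 0%N) => i ilt <-; exists (Ordinal ilt).
Qed.

Lemma row_part (i : 'I_n) : exists2 c, (c < d)%N & nth 0%N lam i = part c.
Proof.
have : nth 0%N lam i \in undup lam by rewrite mem_undup mem_nth.
by case/(nthP 0%N) => c cd <-; exists c.
Qed.

Lemma part_le_head c : (c < d)%N -> (part c <= m)%N.
Proof.
move=> cd; have : part c \in lam by rewrite -mem_undup mem_nth.
case/and3P: lam_part => _; case: lam => //= a s s_sorted _.
rewrite inE => /orP[/eqP->//|].
have geq_trans : transitive geq by move=> x y z xy /leq_trans; apply.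
by have /allP := order_path_min geq_trans s_sorted; apply.
Qed.

Lemma part_interval a j : (a <= d)%N -> (j < part a)%N ->
  exists2 b, (a <= b < d)%N & (part b.+1 <= j < part b)%N.
Proof.
move: {2}(d - a)%N (leqnn (d - a)) => e.
elim: e a => [|e IHe] a ade ad jlt.
  by move: jlt; rewrite (_ : a = d) ?part_d //; lia.
have a_lt : (a < d)%N.
  by rewrite ltn_neqAle ad andbT; apply: contraTneq jlt => ->; rewrite part_d.
have [jle|jlt'] := leqP (part a.+1) j; first by exists a; rewrite ?jle ?leqnn.
have [|b /andP[ab bd] bj] := IHe a.+1 _ a_lt jlt'; first by lia.
by exists b; rewrite // bd ltnW.
Qed.

(** Exponents of the products of the [x_i] with [lam_i = part c], and of the [y_j]
    with [part c.+1 <= j < part c] (indices start at 0). *)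
Definition xblock c : 'X_{1..n + m} :=
  [multinom (match split w with
             | inl i => nth 0%N lam i == part c
             | inr _ => false
             end : nat) | w < n + m].

Definition yblock c : 'X_{1..n + m} :=
  [multinom (match split w with
             | inl _ => false
             | inr j => (part c.+1 <= j < part c)%N
             end : nat) | w < n + m].

Lemma xblock_x c i : xblock c (@xvert lam i) = (nth 0%N lam i == part c).
Proof. by rewrite mnmE /xvert -[lshift _ _]/(unsplit (inl i)) unsplitK. Qed.

Lemma xblock_y c j : xblock c (@yvert lam j) = 0%N.
Proof. by rewrite mnmE /yvert -[rshift _ _]/(unsplit (inr j)) unsplitK. Qed.

Lemma yblock_x c i : yblock c (@xvert lam i) = 0%N.
Proof. by rewrite mnmE /xvert -[lshift _ _]/(unsplit (inl i)) unsplitK. Qed.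

Lemma yblock_y c j : yblock c (@yvert lam j) = (part c.+1 <= j < part c)%N.
Proof. by rewrite mnmE /yvert -[rshift _ _]/(unsplit (inr j)) unsplitK. Qed.

Lemma vertP (w : 'I_(n + m)) :
  (exists i, w = @xvert lam i) \/ (exists j, w = @yvert lam j).
Proof. by case: (split_ordP w) => [i ->|j ->]; [left; exists i | right; exists j]. Qed.

Let u c : S := 'X_[xblock c].
Let v c : S := 'X_[yblock c].

Lemma uprod_factor c (e : 'X_{1..n + m}) : (c <= d)%N ->
    (forall (i : 'I_n) a, (a < c)%N -> nth 0%N lam i = part a ->
       (0 < e (@xvert lam i))%N) ->
  exists q : S, 'X_[e] = uprod u c * q.
Proof.
elim: c e => [|c IHc] e cd eP.
  by exists 'X_[e]; rewrite /uprod big_ord0 mul1r.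
have xe : (xblock c <= e)%MM.
  apply/mnm_lepP => w; case: (vertP w) => [[i ->]|[j ->]]; last by rewrite xblock_y.
  by rewrite xblock_x; case: eqP => // /eP; apply.
have [|i a ac ia|q qE] := IHc (e - xblock c)%MM; first exact: ltnW.
  rewrite mnmBE xblock_x; case: eqP => [ic|_]; last by rewrite subn0 (eP i a) // ltnW.
  have /part_inj ac_eq : part a = part c by rewrite -ia.
  by move: (ac); rewrite ac_eq ?ltnn // (ltn_trans ac).
by exists q; rewrite uprodS -mulrA -qE -mpolyXD addmC submK.
Qed.

(** If block [c] of the y's does not divide a cover, then some [y_j] of that
    block is missing, and the cover contains every [x_i] with [j < lam_i], that is,
    the first [c + 1] blocks of the x's.  Otherwise the block can be divided out. *)
Lemma cover_monomial c (e : 'X_{1..n + m}) : (c <= d)%N ->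
    (forall (i : 'I_n) (j : 'I_m), (part c <= j < nth 0%N lam i)%N ->
       (0 < e (@xvert lam i))%N || (0 < e (@yvert lam j))%N) ->
  chain_pow u v c 1 'X_[e].
Proof.
elim: c e => [|c IHc] // e cd eP.
have [ye|yNe] := boolP (yblock c <= e)%MM.
  rewrite -(submK ye) addmC mpolyXD -[X in X * _]/(v c) -[v c]expr1.
  apply: chain_pow_v.
  apply: IHc => [|i j cj]; first exact: ltnW.
  have := eP i j; rewrite !mnmBE yblock_x yblock_y !subn0.
  have := @part_le c c.+1; rewrite leqnSn cd.
  case/andP: cj => cj ->; rewrite (ltnNge j) cj andbF subn0 andbT.
  by move=> /(_ isT) /leq_trans /(_ cj) ->; apply.
have /existsP[w] : [exists w, ~~ (yblock c w <= e w)%N].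
  by rewrite -negb_forall; apply: contra yNe => /forallP le; apply/mnm_lepP.
case: (vertP w) => [[i ->]|[j0 ->]]; first by rewrite yblock_x.
rewrite yblock_y; have [/andP[cj0 j0c] ej0|//] := boolP (part c.+1 <= j0 < part c)%N.
have [i a ac ia|q ->] := @uprod_factor c.+1 e cd.
  have := eP i j0; rewrite cj0 ia /=.
  rewrite (leq_trans j0c) ?part_le ?(ltnW cd) ?andbT // => /(_ isT)/orP[//|ey].
  by rewrite ey in ej0.
exact: (chain_pow_uprod (chain_pow0 u v c.+1 q)).
Qed.

Local Notation J := (cover_ideal k (ferrers_edges lam)).

Lemma coverP f : J f <->
  forall (i : 'I_n) (j : 'I_m), (j < nth 0%N lam i)%N ->
    f \in ideal_gen [set ('X_w : S) | w in [set` [set @xvert lam i; @yvert lam j]%SET]].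
Proof.
split=> [Jf i j ji|Jf].
  by apply: (Jf [set xvert i; yvert j]%SET); apply/imsetP; exists (i, j); rewrite ?inE.
by move=> e /imsetP[[i j]]; rewrite inE /= => ji ->; apply: Jf.
Qed.

(** A polynomial lies in an ideal generated by variables only if each of its
    monomials does, so all monomials of [f] are vertex covers. *)
Lemma cover_sub f : J f -> chain_pow u v d 1 f.
Proof.
move/coverP=> Jf; rewrite (mpolyE f) big_seq; elim/big_rec: _ => [|e g ef Ig].
  exact: (chain_pow_zero u v d 1).
apply: chain_powD Ig; rewrite -mul_mpolyC; apply: chain_powM.
apply: cover_monomial => // i j /andP[_ /Jf/asboolP[s sA fE]].
apply: contraTT ef; rewrite negb_or -!eqn0Ngt => /andP[/eqP ex /eqP ey].
rewrite mcoeff_msupp negbK fE raddf_sum /= big_seq big1 // => q /sA /= [w + <-].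
rewrite /= !inE => wP; rewrite mulrC mcoeffXM lep1mP.
by case/orP: wP => /eqP->; rewrite ?ex ?ey.
Qed.

Lemma mem_ideal_X (e : 'X_{1..n + m}) w (A : set S) r :
  A 'X_w -> e w != 0%N -> r * 'X_[e] \in ideal_gen A.
Proof.
move=> Aw ew; have we : (U_(w) <= e)%MM by rewrite lep1mP.
rewrite -(submK we) mpolyXD mulrA; exact/ideal_genM/mem_ideal_gen.
Qed.

Lemma cover_gen c : (c <= d)%N -> J (uprod u c * vprod v d c).
Proof.
move=> cd; apply/coverP => i j ji.
have [a ad ia] := row_part i.
have [ac|ca] := ltnP a c.
  rewrite /uprod (bigD1 (Ordinal ac)) //= -mulrA mulrC.
  apply: (@mem_ideal_X _ (xvert i)); last by rewrite xblock_x ia eqxx.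
  by exists (xvert i) => //; rewrite /= !inE eqxx.
have [b bP bj] : exists2 b, (c <= b < d)%N & (part b.+1 <= j < part b)%N.
  by apply: part_interval => //; rewrite (leq_trans ji) // ia part_le // ca ltnW.
rewrite /vprod (bigD1_seq b) /= ?mem_index_iota ?iota_uniq // mulrCA mulrC.
apply: (@mem_ideal_X _ (yvert j)); last by rewrite yblock_y bj.
by exists (yvert j) => //; rewrite /= !inE eqxx orbT.
Qed.

Lemma ferrers_pd t : (1 <= t)%N ->
  pd_eq (quot_mod (ideal_pow J t)) (1 + minn t d).
Proof.
move=> t_gt0.
have d_gt0 : (0 < d)%N.
  rewrite /distinct_parts lt0n size_eq0; apply/eqP => lam0.
  by case/and3P: lam_part; rewrite (undup_nil lam0).
refine (@pd_quot_pow _ u v d (fun c => mdivX (yblock c)) _ _ _ _ _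
         (residue k) _ _ _ J _ _ t t_gt0 d_gt0).
- by move=> c cd; rewrite -msupp_eq0 msuppX.
- by move=> c; apply: mdivX_is_additive.
- by move=> c cd; apply: mdivXK.
- move=> c j f _; apply: mdivX_coprime => w.
  by case: (vertP w) => [[i ->]|[i ->]]; [left; rewrite yblock_x | right; rewrite xblock_y].
- move=> c j f /andP[jc cd]; apply: mdivX_coprime => w.
  case: (vertP w) => [[i ->]|[i ->]]; first by left; rewrite yblock_x.
  rewrite !yblock_y; case: (boolP (part c.+1 <= i < part c)%N) => [/andP[_ ic]|]; last by left.
  right; rewrite [(_ <= i)%N]leqNgt (leq_trans ic) // part_le // jc ltnW //.
- move=> c a cd; have [i ic] := part_row cd.
  by apply: (@residueX_eq0 _ _ _ (xvert i)); rewrite xblock_x ic eqxx.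
- move=> c a cd; have lt := @part_lt c c.+1; rewrite leqnn cd in lt.
  have jm := leq_trans (lt isT) (part_le_head cd).
  apply: (@residueX_eq0 _ _ _ (yvert (Ordinal jm))).
  by rewrite yblock_y /= leqnn lt.
- by exists (1 : k); apply: oner_neq0.
- by move=> f; apply: cover_sub.
- exact: cover_gen.
Qed.

End Ferrers.

Theorem theorem1p1 (k : fieldType) (lam : seq nat) (t : nat) :
  is_partition lam ->
  (1 <= t)%N ->
  pd_eq (quot_mod (ideal_pow (cover_ideal k (ferrers_edges lam)) t))
        (1 + minn t (distinct_parts lam)).
Proof. by move=> lam_part t_gt0; apply: ferrers_pd. Qed.
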